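(* If a reduced $(2K_2,K_4)$-free graph $G$ contains an induced copy of $B_{10}$, then $\mathcal{R}_5(G)$ is connected.
   Context: All graphs are finite and simple. $2K_2$ is the disjoint union of two edges (four vertices), and $K_4$ is the complete graph on four vertices. A graph is $(F_1,\dots,F_k)$-free if it contains no induced subgraph isomorphic to any $F_i$. Containing an induced copy of $B_{10}$ means having an induced subgraph isomorphic to $B_{10}$. Distinct vertices $u,v$ of $G$ are comparable if $N_G(u)\subseteq N_G(v)$ or $N_G(v)\subseteq N_G(u)$, where $N_G$ denotes the open neighborhood. A graph is reduced if it contains no pair of comparable vertices. The reconfiguration graph $\mathcal{R}_5(G)$ has as its vertices the proper $5$-colorings of $G$ (assignments to each vertex of one of $5$ fixed colors such that adjacent vertices receive distinct colors; not all colors need be used), two colorings being adjacent if they differ on exactly one vertex of $G$. The graph $B_{10}$ has vertex set $\{c_1,c_2,c_3,c_4,c_5,f,a,g,y,r\}$ ($10$ vertices). Its edges are: the $5$-cycle edges $c_1c_2,c_2c_3,c_3c_4,c_4c_5,c_5c_1$; the edges between the cycle and the remaining vertices, given by $N(f)\cap C=\{c_2,c_3,c_4,c_5\}$, $N(a)\cap C=\{c_1,c_3,c_4\}$, $N(g)\cap C=\{c_1,c_3,c_4,c_5\}$, $N(y)\cap C=\{c_1,c_3,c_5\}$, $N(r)\cap C=\{c_2,c_5\}$, where $C=\{c_1,\dots,c_5\}$; and the edges $yf,ya,rf,ra,rg$. There are no other edges. *)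

(* Defs.v *)
From mathcomp Require Import all_boot.

Set Implicit Arguments.
Unset Strict Implicit.
Unset Printing Implicit Defensive.

Record sgraph := SGraph {
  vertex :> finType;
  edge : rel vertex;
  edge_sym : symmetric edge;
  edge_irrefl : irreflexive edge }.

Definition nbhd (G : sgraph) (v : G) : {set G} := [set w | edge v w].

Definition comparable (G : sgraph) (u v : G) : bool :=
  (nbhd u \subset nbhd v) || (nbhd v \subset nbhd u).

Definition reduced (G : sgraph) : Prop :=
  forall u v : G, u != v -> ~~ comparable u v.

Definition contains_induced (G F : sgraph) : Prop :=
  exists f : F -> G, injective f /\ forall x y : F, edge (f x) (f y) = edge x y.

Definition free (G F : sgraph) : Prop := ~ contains_induced G F.

(* Following the usual convention, the graph with no vertex is not connected. *)
Definition connected (G : sgraph) : Prop :=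
  0 < #|G| /\ forall x y : G, connect (@edge G) x y.

(* The graph on {0, ..., n-1} given by a list of unordered pairs. *)
Section EdgeList.
Variables (n : nat) (E : seq (nat * nat)).

Definition list_edge : rel 'I_n := fun i j =>
  (i != j) && (((i : nat, j : nat) \in E) || ((j : nat, i : nat) \in E)).

Lemma list_edge_sym : symmetric list_edge.
Proof. by move=> i j; rewrite /list_edge eq_sym orbC. Qed.

Lemma list_edge_irrefl : irreflexive list_edge.
Proof. by move=> i; rewrite /list_edge eqxx. Qed.

Definition list_graph : sgraph := SGraph list_edge_sym list_edge_irrefl.

End EdgeList.

Section Complete.
Variable n : nat.

Definition complete_edge : rel 'I_n := fun i j => i != j.

Lemma complete_edge_sym : symmetric complete_edge.
Proof. by move=> i j; rewrite /complete_edge eq_sym. Qed.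

Lemma complete_edge_irrefl : irreflexive complete_edge.
Proof. by move=> i; rewrite /complete_edge eqxx. Qed.

Definition complete_graph : sgraph :=
  SGraph complete_edge_sym complete_edge_irrefl.

End Complete.

Definition K4 : sgraph := complete_graph 4.

Definition twoK2 : sgraph := list_graph 4 [:: (0, 1); (2, 3)].

Definition B10 : sgraph :=
  let c1 := 0 in let c2 := 1 in let c3 := 2 in let c4 := 3 in let c5 := 4 in
  let f := 5 in let a := 6 in let g := 7 in let y := 8 in let r := 9 in
  list_graph 10
    [:: (c1, c2); (c2, c3); (c3, c4); (c4, c5); (c5, c1);
        (f, c2); (f, c3); (f, c4); (f, c5);
        (a, c1); (a, c3); (a, c4);
        (g, c1); (g, c3); (g, c4); (g, c5);
        (y, c1); (y, c3); (y, c5);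
        (r, c2); (r, c5);
        (y, f); (y, a); (r, f); (r, a); (r, g)].

Section Reconfiguration.
Variables (k : nat) (G : sgraph).

Definition proper_coloring (c : {ffun G -> 'I_k}) : bool :=
  [forall u, forall v, edge u v ==> (c u != c v)].

Definition coloring : finType := {c : {ffun G -> 'I_k} | proper_coloring c}.

Definition reconf_edge : rel coloring := fun c d =>
  #|[set v | val c v != val d v]| == 1.

Lemma reconf_edge_sym : symmetric reconf_edge.
Proof.
move=> c d; rewrite /reconf_edge; congr (#|pred_of_set _| == 1).
by apply/setP=> v; rewrite !inE eq_sym.
Qed.

Lemma reconf_edge_irrefl : irreflexive reconf_edge.
Proof.
move=> c; rewrite /reconf_edge (_ : [set v | _] = set0) ?cards0 //.
by apply/setP=> v; rewrite !inE eqxx.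
Qed.

Definition reconf_graph : sgraph := SGraph reconf_edge_sym reconf_edge_irrefl.

End Reconfiguration.

(* Main.v *)
Require Import Defs.
From mathcomp Require Import all_boot fingroup perm.

Set Implicit Arguments.
Unset Strict Implicit.
Unset Printing Implicit Defensive.

(** Fix an induced copy of B10 in [G]. Excluding 2K2 and K4 leaves 21 possible
sets of neighbours in the copy, the profile of a vertex, and for any two
profiles it often decides whether vertices with these profiles are adjacent.

If [u] and [v] are distinct with the same profile, then, [G] being reduced, each
has a neighbour that is not a neighbour of the other, and these two neighbours
are adjacent, for otherwise there is a 2K2. The profiles exclude this, with one
exception, [typeD] ([twin_eq]). So no vertex outside the copy has the same
profile as a vertex of the copy, which leaves eleven profiles for the vertices
outside. A vertex with one of seven of these would be comparable with a vertex
of the copy ([attached_survivor],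
[not_typeE]), and a vertex of [typeD] would lie in a K4 ([not_typeD]). What
remains outside the copy is at most one vertex for each of three types, where
[typeC] excludes the two others, and vertices of [typeA] and [typeB] are
adjacent. Hence [G] is one of five graphs, with 10, 11 or 12 vertices.

For each of the five graphs the colourings are enumerated up to a renaming of
the colours; there are between 151 and 267 of them. A search shows that every
one can be changed, vertex by vertex, into a fixed colouring that uses only four
of the five colours, up to renaming ([connected_of_search]). Renaming is
harmless at that end: a colouring that misses a colour can be recoloured into
any colouring obtained from it by permuting colours ([connect_perm_unused]). *)

(** * Recolouring vertex by vertex *)

Section Recolouring.

Variables (k : nat) (G : sgraph).
Implicit Types c d : coloring k G.

Lemma coloring_neq c u v : edge u v -> val c u != val c v.
Proof. by move/forallP/(_ u)/forallP/(_ v)/implyP: (valP c). Qed.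

Lemma coloring_of_fun (g : G -> 'I_k) :
  (forall u v, edge u v -> g u != g v) -> {c : coloring k G | val c =1 g}.
Proof.
move=> gP; have fP: proper_coloring [ffun v => g v].
  by apply/forallP=> u; apply/forallP=> v; apply/implyP=> uv; rewrite !ffunE gP.
by exists (exist (@proper_coloring k G) _ fP) => v /=; rewrite ffunE.
Qed.

(** Under this hypothesis every mixture of the two colourings is proper, so the
vertices where they differ can be recoloured one by one, in any order. *)
Lemma connect_mixable c d :
  (forall u v, edge u v -> val c u != val d v) ->
  connect (@reconf_edge k G) c d.
Proof.
have [n] := ubnP #|[set v | val c v != val d v]|.
elim: n c => // n IHn c; rewrite ltnS => le_n cd.
have [diff0|[v]] := set_0Vmem [set v | val c v != val d v].
  suff -> : c = d by apply: connect0.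
  apply/val_inj/ffunP=> v; apply/eqP/negPn.
  by have := in_set0 v; rewrite -diff0 inE => ->.
rewrite inE => cdv; have [|e eE] :=
  @coloring_of_fun (fun u => if u == v then val d v else val c u).
  move=> u w uw; have wu: edge w u by rewrite edge_sym.
  rewrite /=; case: (eqVneq u v) uw wu => [->|_]; case: (eqVneq w v) => [->|_].
  - by rewrite edge_irrefl.
  - by move=> _ wv; rewrite eq_sym cd.
  - by move=> uv _; apply: cd.
  - by move=> uw _; apply: coloring_neq.
have ceE: [set u | val c u != val e u] = [set v].
  apply/setP=> u; rewrite !inE eE.
  by case: (eqVneq u v) => [->//|_]; rewrite eqxx.
apply: (@connect_trans _ _ e).
  by apply: connect1; rewrite /reconf_edge ceE cards1.
apply: IHn => [|u w uw].
  apply: leq_trans le_n; apply/proper_card/properP; split.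
    apply/subsetP=> u; rewrite !inE eE.
    by case: (eqVneq u v) => [->|]; rewrite ?eqxx.
  by exists v; rewrite !inE ?eE ?eqxx ?cdv /=.
rewrite eE; case: (eqVneq u v) uw => [->|_] uw; last exact: cd.
exact: coloring_neq.
Qed.

(** Such a transposition moves one whole colour class to the unused colour. *)
Lemma connect_tperm_unused c d i m :
  (forall v, val c v != m) -> (forall v, val d v = tperm i m (val c v)) ->
  connect (@reconf_edge k G) c d.
Proof.
move=> cm dE; apply: connect_mixable => u v uv; rewrite dE.
have [->|civ] := eqVneq (val c v) i; first by rewrite tpermL.
by rewrite tpermD ?coloring_neq // eq_sym.
Qed.

Lemma coloring_perm c (s : {perm 'I_k}) :
  {d : coloring k G | forall v, val d v = s (val c v)}.
Proof.
by apply: coloring_of_fun => u v uv; rewrite (inj_eq perm_inj) coloring_neq.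
Qed.

(** The unused colour serves as a free cell: a transposition of two used colours
is carried out by moving the colour classes through it. *)
Lemma connect_perm_unused c d (s : {perm 'I_k}) m :
  (forall v, val c v != m) -> (forall v, val d v = s (val c v)) ->
  connect (@reconf_edge k G) c d.
Proof.
have connect_tperm c1 d1 i j m1 : (forall v, val c1 v != m1) ->
    (forall v, val d1 v = tperm i j (val c1 v)) ->
    connect (@reconf_edge k G) c1 d1.
  move=> c1m d1E; have [jm|jm] := eqVneq j m1.
    by apply: (@connect_tperm_unused _ _ i m1) => // v; rewrite d1E jm.
  have [im|im] := eqVneq i m1.
    by apply: (@connect_tperm_unused _ _ j m1) => // v; rewrite d1E im tpermC.
  have [ij|ij] := eqVneq i j.
    by apply: (@connect_tperm_unused _ _ m1 m1) => // v; rewrite d1E ij !tperm1.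
  (* (i j) = (i m1), then (j i), then (m1 j): each step renames one class to the
     colour that is unused at that moment. *)
  have [c2 c2E] := coloring_perm c1 (tperm i m1).
  have [c3 c3E] := coloring_perm c2 (tperm j i).
  have c2i v : val c2 v != i.
    by rewrite c2E -{2}(tpermR i m1) (inj_eq perm_inj).
  have c3j v : val c3 v != j.
    by rewrite c3E -{2}(tpermR j i) (inj_eq perm_inj).
  apply: (@connect_trans _ _ c2); first exact: connect_tperm_unused c1m c2E.
  apply: (@connect_trans _ _ c3); first exact: connect_tperm_unused c2i c3E.
  apply: (connect_tperm_unused (i := m1) c3j) => v.
  rewrite d1E c3E c2E; move: (c1m v).
  have [->|ci] := eqVneq (val c1 v) i.
    by rewrite !tpermL [in RHS](tpermD jm im) tpermL.
  have [->|cj] := eqVneq (val c1 v) j.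
    rewrite (tpermD (x := i) (y := m1)) // 1?eq_sym // tpermL tpermR.
    by rewrite tpermD // eq_sym.
  by move=> cm; rewrite !tpermD // eq_sym.
case: (prod_tpermP s) => ts -> _; elim: ts c m => [|t ts IHts] c m cm dE.
  apply: (connect_tperm c d m m m cm) => v.
  by rewrite dE big_nil tperm1 !perm1.
have [e eE] := coloring_perm c (tperm t.1 t.2).
apply: (@connect_trans _ _ e); first exact: connect_tperm cm eE.
apply: (IHts e (tperm t.1 t.2 m)) => v.
  by rewrite eE (inj_eq perm_inj).
by rewrite dE big_cons permM eE.
Qed.

End Recolouring.

(** * Normal forms of colourings and the search for a recolouring *)

Section Canon.

Definition palette (T : eqType) (s : seq T) := rev (undup s).

(** Two lists of colours have the same normal form when they differ by a
renaming of the colours. *)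
Definition canon (T : eqType) (s : seq T) := [seq index x (palette s) | x <- s].

(** The numbering of the colours used in [canon s], extended to the colours that
do not occur in [s], so as to be injective on [T]. *)
Definition label (T : finType) (s : seq T) (x : T) :=
  index x (palette (enum T ++ s)).

Lemma canon_map (T T' : eqType) (h : T -> T') (s : seq T) :
  injective h -> canon [seq h x | x <- s] = canon s.
Proof.
move=> h_inj; rewrite /canon /palette undup_map_inj // -map_rev -map_comp.
by apply: eq_map => x /=; rewrite index_map.
Qed.

(** Colours are numbered from the right end of the list, so that the number of a
colour does not change when the list is extended to the left. *)
Lemma index_palette_cat (T : eqType) (s t : seq T) x :
  x \in t -> index x (palette (s ++ t)) = index x (palette t).
Proof.
by move=> xt; rewrite /palette undup_cat rev_cat index_cat mem_rev mem_undup xt.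
Qed.

Variable T : finType.
Implicit Types (s t : seq T) (x : T).

Lemma mem_full_palette s x : x \in palette (enum T ++ s).
Proof. by rewrite mem_rev mem_undup mem_cat mem_enum. Qed.

Lemma full_palette_uniq s : uniq (palette (enum T ++ s)).
Proof. by rewrite rev_uniq undup_uniq. Qed.

Lemma size_full_palette s : size (palette (enum T ++ s)) = #|T|.
Proof.
apply/eqP; rewrite cardE eq_sym -(uniq_size_uniq (full_palette_uniq s)).
  exact: enum_uniq.
by move=> x; rewrite mem_full_palette mem_enum.
Qed.

Lemma label_inj s : injective (label s).
Proof.
move=> x y eq_xy; rewrite -(nth_index x (mem_full_palette s x)).
by rewrite -[index x _]/(label s x) eq_xy nth_index ?mem_full_palette.
Qed.

Lemma label_lt s x : label s x < #|T|.
Proof. by rewrite -(size_full_palette s) index_mem mem_full_palette. Qed.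

Lemma label_nth s x0 i :
  i < #|T| -> label s (nth x0 (palette (enum T ++ s)) i) = i.
Proof.
by move=> i_lt; rewrite /label index_uniq ?full_palette_uniq ?size_full_palette.
Qed.

Lemma canonE s t : [seq label (s ++ t) x | x <- t] = canon t.
Proof.
by apply/eq_in_map => x xt; rewrite /label catA index_palette_cat.
Qed.

Lemma canon_cons x s : canon (x :: s) = label (x :: s) x :: canon s.
Proof. by rewrite -(canonE [::]) -(canonE [:: x]). Qed.

Lemma label_head_le x s : label (x :: s) x <= size (undup s).
Proof.
rewrite /label index_palette_cat ?mem_head // -ltnS.
apply: (@leq_trans (size (undup (x :: s)))); last by rewrite /=; case: ifP.
by rewrite -size_rev index_mem mem_rev mem_undup mem_head.
Qed.

End Canon.

(** [free_for row o w x]: if [w] lists the colours of the vertices numbered from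
[o] on, colour [x] does not occur on the neighbours listed in [row]. *)
Definition free_for (row : seq nat) (o : nat) (w : seq nat) (x : nat) :=
  all (fun j => (j \in row) ==> (nth 0 w (j - o) != x)) (iota o (size w)).

(** The normal forms of the colourings with [k] colours of the vertices numbered
from [o] on, whose lists of neighbours are [rows]. As a new colour always gets
the next number, the first colour of a list is at most the number of colours
that occur in its tail. *)
Fixpoint normal_forms (k : nat) (rows : seq (seq nat)) (o : nat) :
    seq (seq nat) :=
  if rows is row :: rows' then
    [seq x :: w | w <- normal_forms k rows' o.+1,
                  x <- [seq x <- iota 0 (minn k (size (undup w)).+1)
                          | free_for row o.+1 w x]]
  else [:: [::]].

(** The normal forms of the colourings obtained from [w] by recolouring one
vertex. *)
Definition moves (k : nat) (rows : seq (seq nat)) (w : seq nat) :=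
  [seq canon (set_nth 0 w i x) | i <- iota 0 (size w),
     x <- [seq x <- iota 0 k
             | (x != nth 0 w i) && free_for (nth [::] rows i) 0 w x]].

(** [U] lists the normal forms not yet known to lead to the target, each with
its moves; those with a move to a normal form outside the list are deleted. *)
Definition prune (U : seq (seq nat * seq (seq nat))) :=
  let W := unzip1 U in [seq p <- U | all (fun w => w \in W) p.2].

(** The target [w0] has its colours below [k], so that the last one of the
[k.+1] colours is missing in it. The number of rounds only has to
be large enough. *)
Definition search (k : nat) (rows : seq (seq nat)) (w0 : seq nat) :=
  [&& size w0 == size rows, all (gtn k) w0, canon w0 == w0,
      all (fun i => free_for (nth [::] rows i) 0 w0 (nth 0 w0 i))
          (iota 0 (size w0))
    & nilp (iter (size rows) prune
        [seq (w, moves k.+1 rows w)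
           | w <- normal_forms k.+1 rows 0 & w != w0])].

Section Search.

Variables (k : nat) (G : sgraph) (x0 : G) (s : seq G) (rows : seq (seq nat)).
Hypothesis s_all : forall v, v \in s.
Hypothesis s_uniq : uniq s.
Hypothesis rows_size : size rows = size s.
Hypothesis rows_edge : forall i j, i < size s -> j < size s ->
  edge (nth x0 s i) (nth x0 s j) = (j \in nth [::] rows i).

Implicit Types c d : coloring k.+1 G.

(** By induction on the number of vertices from [o] on: the colour numbers of
the tail of a list do not change when the list gets a new head. *)
Lemma normal_forms_complete c o :
  o <= size s ->
  canon [seq val c v | v <- drop o s] \in normal_forms k.+1 (drop o rows) o.
Proof.
move=> o_le; have [n le_n] := ubnP (size s - o).
elim: n o o_le le_n => // n IHn o o_le; rewrite ltnS => le_n.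
have [o_lt|o_ge] := ltnP o (size s); last first.
  by rewrite !drop_oversize ?rows_size.
rewrite (drop_nth x0) // (drop_nth [::]) ?rows_size //=.
set t := drop o.+1 s; set x := val c (nth x0 s o); set ct := map _ t.
rewrite canon_cons; apply/allpairsPdep.
exists (canon ct), (label (x :: ct) x); split=> //.
  by apply: IHn => //; rewrite -ltnS subnSK.
have sizeE : size (undup (canon ct)) = size (undup ct).
  rewrite -(canonE [:: x]) undup_map_inj ?size_map //; exact: label_inj.
have := label_lt (x :: ct) x; rewrite card_ord => l_lt.
rewrite mem_filter mem_iota add0n leq_min sizeE l_lt ltnS label_head_le !andbT.
apply/allP=> j; rewrite mem_iota !size_map size_drop => /andP[oj j_lt].
have j_s : j < size s by rewrite subnKC // in j_lt.
apply/implyP=> jo; rewrite -(canonE [:: x]) (nth_map x) ?size_map ?size_drop.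
  rewrite (inj_eq (@label_inj _ _)) (nth_map x0) ?size_drop ?ltn_sub2r //.
    by rewrite nth_drop subnKC // coloring_neq // edge_sym rows_edge.
  by apply: leq_ltn_trans j_s.
by rewrite ltn_sub2r // (leq_ltn_trans oj).
Qed.

(** A move between normal forms lifts to every colouring with the first one as
normal form: the recoloured vertex receives the colour whose label is the new
number. *)
Lemma moves_sound c w :
  w \in moves k.+1 rows (canon [seq val c v | v <- s]) ->
  exists2 d, connect (@reconf_edge k.+1 G) c d
           & canon [seq val d v | v <- s] = w.
Proof.
set cs := map _ s => /allpairsPdep[i [x []]].
rewrite mem_filter !mem_iota !size_map !add0n.
move=> /andP[_ i_lt] /andP[/andP[_ x_free] /andP[_ x_lt]] ->.
pose y := nth ord0 (palette (enum 'I_k.+1 ++ cs)) x.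
have yE : label cs y = x by rewrite label_nth ?card_ord.
have y_free u : edge (nth x0 s i) u -> val c u != y.
  move=> iu; have uE := nth_index x0 (s_all u).
  have u_lt : index u s < size s by rewrite index_mem.
  rewrite -uE rows_edge // in iu.
  move/allP/(_ (index u s)): x_free; rewrite mem_iota !size_map add0n u_lt iu.
  rewrite subn0 -(canonE [::]) (nth_map ord0) ?size_map // (nth_map x0) // uE.
  by rewrite -{1}yE (inj_eq (@label_inj _ _)) => /(_ isT).
have [|d dE] :=
  @coloring_of_fun k.+1 G (fun u => if u == nth x0 s i then y else val c u).
  move=> u v uv /=; have [ui|_] := eqVneq u; have [vi|_] := eqVneq v.
  - by rewrite ui vi edge_irrefl in uv.
  - by rewrite eq_sym y_free -?ui.
  - by rewrite y_free // -vi edge_sym.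
  - exact: coloring_neq.
exists d.
  apply: connect_mixable => u v uv; rewrite dE.
  have [vi|_] := eqVneq v; last exact: coloring_neq.
  by rewrite y_free // -vi edge_sym.
rewrite -(canon_map _ (@label_inj _ cs)); congr canon.
apply: (@eq_from_nth _ 0) => [|j].
  by rewrite size_set_nth !size_map; apply/esym/maxn_idPr.
rewrite !size_map => j_lt; rewrite nth_set_nth /=.
rewrite (nth_map ord0) ?size_map // (nth_map x0) // dE nth_uniq //.
have [_|_] := eqVneq j i; first exact: yE.
by rewrite -(canonE [::]) (nth_map ord0) ?size_map // (nth_map x0).
Qed.

(** The two colourings differ by a permutation of the colours, and the colour
with label [k] is unused. *)
Lemma connect_same_canon c d :
  canon [seq val c v | v <- s] = canon [seq val d v | v <- s] ->
  all (gtn k) (canon [seq val c v | v <- s]) ->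
  connect (@reconf_edge k.+1 G) c d.
Proof.
set cs := map _ s; set ds := map _ s => cdE cs_lt.
have labelE v : label cs (val c v) = label ds (val d v).
  have := congr1 (nth 0 ^~ (index v s)) cdE.
  rewrite -!(canonE [::]) !(nth_map ord0) ?size_map ?index_mem //.
  by rewrite !(nth_map x0) ?index_mem // nth_index.
pose h x := nth ord0 (palette (enum 'I_k.+1 ++ ds)) (label cs x).
have hE x : label ds (h x) = label cs x by rewrite label_nth ?label_lt.
have h_inj : injective h.
  by move=> x y hxy; apply: (@label_inj _ cs); rewrite -!hE hxy.
apply: (@connect_perm_unused _ _ c d (perm h_inj)
          (nth ord0 (palette (enum 'I_k.+1 ++ cs)) k)) => v.
  have lt_k : label cs (val c v) < k.
    by apply: (allP cs_lt); rewrite -(canonE [::]) !map_f.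
  by rewrite -(inj_eq (@label_inj _ cs)) label_nth ?card_ord // neq_ltn lt_k.
by rewrite permE; apply: (@label_inj _ ds); rewrite hE labelE.
Qed.

(** Throughout the search every colouring whose normal form is outside the list
is joined to the target: a deleted normal form has a move that leads outside the
list. When the list is empty, this is every colouring. *)
Theorem connected_of_search w0 :
  search k rows w0 -> connected (reconf_graph k.+1 G).
Proof.
case/and5P=> /eqP w0_size w0_lt /eqP w0_canon w0_proper /nilP searchE.
rewrite rows_size in w0_size.
have w0v_lt v : nth 0 w0 (index v s) < k.
  by apply: (allP w0_lt); rewrite mem_nth // w0_size index_mem.
have [|c0 c0E] :=
  @coloring_of_fun k.+1 G (fun v => inord (nth 0 w0 (index v s))).
  move=> u v; rewrite -{1}(nth_index x0 (s_all u)) -{1}(nth_index x0 (s_all v)).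
  rewrite rows_edge ?index_mem // => uv.
  rewrite -val_eqE /= !inordK ?ltnS ?(ltnW (w0v_lt _)) //.
  move/allP: w0_proper => /(_ (index u s)).
  rewrite mem_iota w0_size index_mem s_all => /(_ isT).
  move/allP/(_ (index v s)); rewrite mem_iota w0_size index_mem s_all uv subn0.
  by rewrite eq_sym => /(_ isT).
have c0_canon : canon [seq val c0 v | v <- s] = w0.
  rewrite -[RHS]w0_canon -(canon_map _ val_inj); congr canon.
  apply: (@eq_from_nth _ 0) => [|i]; rewrite !size_map // => i_lt.
  rewrite (nth_map ord0) ?size_map // (nth_map x0) // c0E.
  by rewrite -{2}(index_uniq x0 i_lt s_uniq) /= inordK // ltnS ltnW.
suff all_c0 c : connect (@reconf_edge k.+1 G) c c0.
  split; first by apply/card_gt0P; exists c0.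
  move=> c d; apply: connect_trans (all_c0 c) _.
  rewrite (sym_connect_sym (@reconf_edge_sym _ _)); exact: all_c0.
pose joined (U : seq (seq nat * seq (seq nat))) := forall c,
  canon [seq val c v | v <- s] \notin unzip1 U ->
  connect (@reconf_edge k.+1 G) c c0.
pose well_formed (U : seq (seq nat * seq (seq nat))) := forall p,
  p \in U -> p.2 = moves k.+1 rows p.1.
suff: forall n U, joined U -> well_formed U -> joined (iter n prune U).
  set U0 := map _ _ in searchE; move/(_ (size rows) U0); rewrite searchE.
  move=> joined_nil; apply: joined_nil => // [d | p /mapP[w _ ->] //].
  rewrite /unzip1 -map_comp map_id mem_filter.
  have := normal_forms_complete d (leq0n _); rewrite !drop0 => ->.
  rewrite andbT negbK => /eqP dE.
  by apply: connect_same_canon; rewrite dE ?c0_canon.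
elim=> // n IHn U joinedU wfU; rewrite iterSr; apply: IHn => [d|p]; last first.
  by rewrite mem_filter => /andP[_ /wfU].
have [dU|] := boolP (canon [seq val d v | v <- s] \in unzip1 U); last first.
  by move=> dU _; apply: joinedU.
case/mapP: dU => p pU pE dU.
have: ~~ all (fun w => w \in unzip1 U) p.2.
  apply: contra dU => p2U; rewrite pE map_f // mem_filter pU andbT; exact: p2U.
case/allPn=> w; rewrite (wfU p pU) -pE => /moves_sound[e de eE] wU.
by apply: connect_trans de _; apply: joinedU; rewrite eE.
Qed.

End Search.

(** * Vertices around a copy of B10 *)

(** The vertices c1, ..., c5, f, a, g, y, r are numbered 0, ..., 9. *)
Definition B10_rows : seq (seq nat) :=
  [:: [:: 1; 4; 6; 7; 8];
      [:: 0; 2; 5; 9];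
      [:: 1; 3; 5; 6; 7; 8];
      [:: 2; 4; 5; 6; 7];
      [:: 0; 3; 5; 7; 8; 9];
      [:: 1; 2; 3; 4; 8; 9];
      [:: 0; 2; 3; 8; 9];
      [:: 0; 2; 3; 4; 9];
      [:: 0; 2; 4; 5; 6];
      [:: 1; 4; 5; 6; 7]].

Definition B10_adj (i j : nat) := j \in nth [::] B10_rows i.

Definition B10_edges :=
  [seq (i, j) | i <- iota 0 10, j <- [seq j <- nth [::] B10_rows i | i < j]].

Fixpoint sublists (s : seq nat) : seq (seq nat) :=
  if s is x :: s' then let L := sublists s' in L ++ [seq x :: t | t <- L]
  else [:: [::]].

Lemma filter_sublists (p : pred nat) s : [seq x <- s | p x] \in sublists s.
Proof.
elim: s => //= x s IHs; rewrite mem_cat; case: (p x); last by rewrite IHs.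
by rewrite map_f ?orbT.
Qed.

(** [S] can be the set of neighbours in the copy of B10 of a further vertex; the
condition excludes 2K2 and the conclusion K4, both through that vertex. *)
Definition admissible (S : seq nat) :=
  if all (fun i => all (fun p =>
       [|| p.1 \in S, p.2 \in S, B10_adj i p.1 | B10_adj i p.2]) B10_edges) S
  then all (fun i =>
         let N := [seq j <- S | B10_adj i j] in
         all (fun j => all (fun l => ~~ B10_adj j l) N) N) S
  else false.

Definition profiles := [seq S <- sublists (iota 0 10) | admissible S].

(** Vertices with neighbourhoods [S] and [T] in the copy of B10 can be adjacent
(if [e]) or nonadjacent (otherwise). *)
Definition compatible (e : bool) (S T : seq nat) :=
  if e then
    all (fun p => [|| p.1 \in S, p.2 \in S, p.1 \in T | p.2 \in T]) B10_edges &&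
    all (fun i => all (fun j => ~~ B10_adj i j) [seq j <- S | j \in T])
        [seq i <- S | i \in T]
  else
    all (fun i => all (fun j => [|| i \in T, j \in S | B10_adj i j]) T) S.

(** The profiles that a vertex adjacent to one but not to another vertex of
profile [S] can have. *)
Definition undetermined S :=
  [seq W <- profiles | compatible true S W && compatible false S W].

(** Two vertices of profile [S] cannot be adjacent, and private neighbours of
them cannot be adjacent either. *)
Definition twinless S :=
  let Q := undetermined S in
  ~~ compatible true S S &&
  all (fun W => all (fun W' => ~~ compatible true W W') Q) Q.

(** The profiles of the vertices outside the copy of B10, once it is known that
they differ from those of the vertices in the copy. *)
Definition attached := [seq S <- profiles | S \notin B10_rows].

(** Every neighbour of a vertex of profile [T] is a neighbour of vertex [i] of
the copy. *)
Definition below T i :=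
  all (B10_adj i) T &&
  all (fun S => compatible true T S ==> (i \in S)) attached.

Definition survivors := [seq T <- attached | ~~ has (below T) (iota 0 10)].

(** Vertices of types A, B and C can occur; the types D and E pass the test that
defines [survivors] but are excluded by further arguments. *)
Definition typeA := [:: 0; 1; 3; 5; 7; 8].
Definition typeB := [:: 1; 3; 4; 6; 8; 9].
Definition typeC := [:: 1; 3; 7; 8; 9].
Definition typeD := [:: 0; 2; 3; 9].
Definition typeE := [:: 0; 2; 5; 6; 7; 9].

(** The copy of B10 together with pairwise adjacent further vertices of profiles
[Ps], numbered from 10 on. *)
Definition ext_adj (Ps : seq (seq nat)) (i j : nat) :=
  if i < 10 then
    if j < 10 then B10_adj i j else i \in nth [::] Ps (j - 10)
  else if j < 10 then j \in nth [::] Ps (i - 10) else i != j.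

Definition ext_rows Ps :=
  let n := 10 + size Ps in
  [seq [seq j <- iota 0 n | ext_adj Ps i j] | i <- iota 0 n].

Lemma twinless_profiles : {in profiles, forall S, S != typeD -> twinless S}.
Proof.
have /allP check : all (fun S => (S == typeD) || twinless S) profiles.
  by vm_compute.
by move=> S /check /orP[-> | ].
Qed.

Lemma survivorsE : survivors = [:: typeC; typeB; typeE; typeD; typeA].
Proof. by vm_compute. Qed.

Lemma types_attached : {subset [:: typeC; typeB; typeA] <= attached}.
Proof. by apply/allP; vm_compute. Qed.

Section AroundB10.

Variables (G : sgraph) (b : nat -> G).
Hypothesis G_reduced : reduced G.
Hypothesis G_2K2 : forall x y z t : G, edge x y -> edge z t ->
  [|| edge x z, edge x t, edge y z | edge y t].
Hypothesis G_K4 : forall x y z t : G,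
  ~~ [&& edge x y, edge x z, edge x t, edge y z, edge y t & edge z t].
Hypothesis b_edge : forall i j, i < 10 -> j < 10 ->
  edge (b i) (b j) = B10_adj i j.
Hypothesis b_inj : {in gtn 10 &, injective b}.

Implicit Types u v w : G.

Definition profile v := [seq i <- iota 0 10 | edge v (b i)].

Lemma mem_profile v i : (i \in profile v) = (i < 10) && edge v (b i).
Proof. by rewrite mem_filter mem_iota andbC. Qed.

Lemma private_neighbour u v : u != v -> exists2 w : G, edge u w & ~~ edge v w.
Proof.
move/G_reduced; rewrite negb_or => /andP[/subsetPn[w]]; rewrite !inE.
by exists w.
Qed.

Lemma B10_edgesP p :
  p \in B10_edges -> [/\ p.1 < 10, p.2 < 10 & B10_adj p.1 p.2].
Proof.
have /allP check :
  all (fun p => [&& p.1 < 10, p.2 < 10 & B10_adj p.1 p.2]) B10_edges.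
  by vm_compute.
by move/check/and3P.
Qed.

Lemma B10_edge p : p \in B10_edges -> edge (b p.1) (b p.2).
Proof. by case/B10_edgesP=> p1 p2 p12; rewrite b_edge. Qed.

Lemma profile_in_profiles v : profile v \in profiles.
Proof.
rewrite mem_filter filter_sublists andbT /admissible.
case: ifP => [_|/negP[]]; apply/allP=> i.
  rewrite mem_profile => /andP[i_lt vi].
  apply/allP=> j; rewrite mem_filter mem_profile => /and3P[ij j_lt vj].
  apply/allP=> l; rewrite mem_filter mem_profile => /and3P[il l_lt vl].
  have := G_K4 v (b i) (b j) (b l).
  by rewrite vi vj vl !b_edge // ij il.
rewrite mem_profile => /andP[i_lt vi]; apply/allP=> p pE.
have [p1 p2 _] := B10_edgesP pE.
by have := G_2K2 vi (B10_edge pE); rewrite !mem_profile p1 p2 !b_edge.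
Qed.

Lemma profile_compatible u v : compatible (edge u v) (profile u) (profile v).
Proof.
rewrite /compatible; case: ifP => [uv|uv]; last first.
  apply/allP=> i; rewrite mem_profile => /andP[i_lt ui].
  apply/allP=> j; rewrite mem_profile => /andP[j_lt vj].
  rewrite !mem_profile i_lt j_lt -b_edge //=.
  have := G_2K2 ui vj; rewrite uv (edge_sym (b i) v) /=.
  by case/or3P=> ->; rewrite ?orbT.
apply/andP; split.
  apply/allP=> p pE; have [p1 p2 _] := B10_edgesP pE.
  by have := G_2K2 uv (B10_edge pE); rewrite !mem_profile p1 p2.
apply/allP=> i; rewrite mem_filter !mem_profile => /and3P[/andP[i_lt vi] _ ui].
apply/allP=> j; rewrite mem_filter !mem_profile => /and3P[/andP[j_lt vj] _ uj].
by have := G_K4 u v (b i) (b j); rewrite uv ui uj vi vj b_edge.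
Qed.

(** Private neighbours [w] of [u] and [w'] of [v] are adjacent, because the edges
[u w] and [v w'] would form a 2K2 otherwise; but [twinless] says that they are
not. *)
Lemma twin_eq u v : profile u = profile v -> profile u != typeD -> u = v.
Proof.
move=> uv uD; apply/eqP/negPn/negP=> neq_uv.
have [] := andP (twinless_profiles (profile_in_profiles u) uD).
set S := profile u => /negP SS /allP free_SS.
have nuv: ~~ edge u v.
  apply/negP=> e_uv; apply: SS; rewrite {2}/S uv -e_uv.
  exact: profile_compatible.
have [w uw vw] := private_neighbour neq_uv.
have [|w' vw' uw'] := @private_neighbour v u; first by rewrite eq_sym.
have und x y z : edge x z -> ~~ edge y z -> profile x = S -> profile y = S ->
    profile z \in undetermined S.
  move=> xz /negbTE yz xS yS; rewrite mem_filter profile_in_profiles andbT.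
  by have := profile_compatible x z; have := profile_compatible y z;
    rewrite xz yz xS yS => -> ->.
have wS := und u v w uw vw erefl (esym uv).
have w'S := und v u w' vw' uw' (esym uv) erefl.
move/(_ _ wS)/allP/(_ _ w'S)/negP: free_SS; apply.
have <- : edge w w' = true; last exact: profile_compatible.
have := G_2K2 uw vw'; rewrite (negbTE nuv) (negbTE uw') (edge_sym w v).
by rewrite (negbTE vw) => /=.
Qed.

Lemma profile_b i : i < 10 -> profile (b i) = nth [::] B10_rows i.
Proof.
move=> i_lt.
have /allP check : all (fun i => [seq j <- iota 0 10 | B10_adj i j] ==
  nth [::] B10_rows i) (iota 0 10) by vm_compute.
rewrite -(eqP (check i _)) ?mem_iota //; apply: eq_in_filter => j.
by rewrite mem_iota => j_lt; rewrite b_edge.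
Qed.

(** A vertex with the profile of a vertex in the copy is that vertex, by
[twin_eq]. *)
Lemma base_or_attached v :
  (exists2 i, i < 10 & v = b i) \/ profile v \in attached.
Proof.
have [/(nthP [::])[i i_lt iE]|nv] := boolP (profile v \in B10_rows); last first.
  by right; rewrite mem_filter nv profile_in_profiles.
left; exists i => //; apply: twin_eq; rewrite -iE ?profile_b //.
have /allP check : all (fun S => S != typeD) B10_rows by vm_compute.
by apply: check; rewrite mem_nth.
Qed.

Lemma attached_neq v i : profile v \in attached -> i < 10 -> v != b i.
Proof.
rewrite mem_filter => /andP[nv _] i_lt; apply: contraNneq nv => ->.
by rewrite profile_b // mem_nth.
Qed.

Lemma compatible_edge u v e :
  compatible e (profile u) (profile v) = false -> edge u v = ~~ e.
Proof.
by have := profile_compatible u v; case: (edge u v) e => [] [] // ->.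
Qed.

(** A vertex below a vertex of the copy is comparable with it. *)
Lemma attached_survivor v : profile v \in attached -> profile v \in survivors.
Proof.
move=> v_att; rewrite mem_filter v_att andbT; apply/hasPn=> i.
rewrite mem_iota => /= i_lt; apply/negP=> /andP[/allP v_i /allP att_i].
have [w vw] := private_neighbour (attached_neq v_att i_lt).
have [[j j_lt wE]|w_att] := base_or_attached w.
  by rewrite wE b_edge // v_i // mem_profile j_lt -wE.
move/implyP: (att_i _ w_att); rewrite -{1}vw profile_compatible => /(_ isT).
by rewrite mem_profile edge_sym => /andP[_ ->].
Qed.

(** The neighbourhood of a vertex of type E would contain that of [c2]: no
surviving profile with [c2] in it allows nonadjacency to a vertex of type E. *)
Lemma not_typeE v : profile v != typeE.
Proof.
apply/negP=> /eqP vE.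
have v_att : profile v \in attached by rewrite vE; vm_compute.
have neq_v : b 1 != v by rewrite eq_sym attached_neq.
have [w b1w vw] := private_neighbour neq_v.
have [[j j_lt wE]|w_att] := base_or_attached w.
  have /allP check : all (fun j => j \in typeE) (nth [::] B10_rows 1) by [].
  move: b1w vw; rewrite wE b_edge // => /check; rewrite -vE mem_profile.
  by case/andP=> _ ->.
have /allP check :
    all (fun S => (1 \in S) ==> ~~ compatible false typeE S) survivors.
  by vm_compute.
have w1 : 1 \in profile w by rewrite mem_profile edge_sym.
have := implyP (check _ (attached_survivor w_att)) w1.
by rewrite -vE -{1}(negbTE vw) profile_compatible.
Qed.

(** A vertex [v] of type D is not comparable with [b i], although [b i] has all
the neighbours of [v] in the copy; so [v] has a neighbour outside the copy that
is not adjacent to [b i], and its profile is known. *)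
Lemma private_of_typeD v i S :
  profile v = typeD -> i < 10 -> all (B10_adj i) typeD ->
  {in survivors, forall T, compatible true typeD T -> i \notin T -> T = S} ->
  exists2 w : G, edge v w & profile w = S.
Proof.
move=> vD i_lt /allP Di onlyS.
have v_att : profile v \in attached by rewrite vD; vm_compute.
have [w vw biw] := private_neighbour (attached_neq v_att i_lt).
exists w; first exact: vw.
have [[j j_lt wE]|w_att] := base_or_attached w.
  case/negP: biw; rewrite wE b_edge //; apply: Di.
  by rewrite -vD mem_profile j_lt -wE.
apply: onlyS; first exact: attached_survivor.
  by rewrite -vD -vw profile_compatible.
by rewrite mem_profile edge_sym (negbTE biw) andbF.
Qed.

(** Comparing [v] with the vertices [a] and [g] of the copy yields neighbours of
[v] of types A and B. These are adjacent, and with [v] and [c4] they form a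
K4. *)
Lemma not_typeD v : profile v != typeD.
Proof.
apply/negP=> /eqP vD.
have only i S :
    all (fun T => compatible true typeD T ==> (i \notin T) ==> (T == S))
      survivors ->
  {in survivors, forall T, compatible true typeD T -> i \notin T -> T = S}.
  by move/allP=> check T /check /implyP impl /impl /implyP TS /TS /eqP.
have onlyA : {in survivors, forall T,
    compatible true typeD T -> 6 \notin T -> T = typeA}.
  by refine (only 6 typeA _); vm_compute.
have onlyB : {in survivors, forall T,
    compatible true typeD T -> 7 \notin T -> T = typeB}.
  by refine (only 7 typeB _); vm_compute.
have [w vw wA] := private_of_typeD vD (isT : 6 < 10) isT onlyA.
have [w' vw' wB] := private_of_typeD vD (isT : 7 < 10) isT onlyB.
have ww' : edge w w'.
  by rewrite (@compatible_edge w w' false) // wA wB; vm_compute.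
have b3 u : 3 \in profile u -> edge u (b 3) by rewrite mem_profile => /andP[].
have := G_K4 v w w' (b 3).
by rewrite vw vw' ww' !b3 ?vD ?wA ?wB.
Qed.

Lemma attached_types v :
  profile v \in attached -> profile v \in [:: typeC; typeB; typeA].
Proof.
move/attached_survivor; rewrite survivorsE !inE.
by rewrite (negbTE (not_typeD v)) (negbTE (not_typeE v)).
Qed.

(** The copy and [vs] together list every vertex once, so [G] is the graph given
by the rows that are searched. *)
Lemma connected_ext vs target :
  uniq vs -> (forall u v, u \in vs -> v \in vs -> u != v -> edge u v) ->
  (forall v, profile v \in attached -> v \in vs) ->
  (forall v, v \in vs -> profile v \in attached) ->
  search 4 (ext_rows [seq profile v | v <- vs]) target ->
  connected (reconf_graph 5 G).
Proof.
move=> vs_uniq vs_edge att_vs vs_att.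
set s := [seq b i | i <- iota 0 10] ++ vs.
have s_size : size s = 10 + size vs by rewrite size_cat size_map size_iota.
have s_nth i : nth (b 0) s i = if i < 10 then b i else nth (b 0) vs (i - 10).
  rewrite nth_cat size_map size_iota; case: ifP => // i_lt.
  by rewrite (nth_map 0) ?size_iota // nth_iota.
apply: (@connected_of_search 4 G (b 0) s) => [v|||i j].
- rewrite mem_cat; have [[i i_lt ->]|/att_vs ->] := base_or_attached v.
    by rewrite map_f // mem_iota.
  by rewrite orbT.
- rewrite cat_uniq vs_uniq andbT map_inj_in_uniq ?iota_uniq ?andTb.
    apply/hasPn=> v /vs_att v_att; apply/negP=> /mapP[i].
    by rewrite mem_iota => i_lt; apply/eqP/attached_neq.
  by move=> i j; rewrite !mem_iota; apply: b_inj.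
- by rewrite s_size size_map size_iota size_map.
rewrite s_size => i_lt j_lt; rewrite !s_nth (nth_map 0) ?size_iota ?size_map //.
rewrite mem_filter mem_iota nth_iota ?size_map //.
rewrite leq0n j_lt !andbT /ext_adj !add0n.
have sub_lt l : l < 10 + size vs -> 10 <= l -> l - 10 < size vs.
  by move=> l_lt l_ge; rewrite ltn_subLR.
case: (ltnP i 10) => i10; case: (ltnP j 10) => j10; first exact: b_edge.
- by rewrite (nth_map (b 0)) ?sub_lt // mem_profile i10 edge_sym.
- by rewrite (nth_map (b 0)) ?sub_lt // mem_profile j10.
have [->|ij] := eqVneq i j; first by rewrite edge_irrefl.
apply: vs_edge; rewrite ?mem_nth ?sub_lt // nth_uniq ?sub_lt //.
by apply: contra ij => /eqP ij; rewrite -(subnKC i10) ij subnKC.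
Qed.

End AroundB10.

(** * The theorem *)

Lemma twoK2_free_edges (G : sgraph) : free G twoK2 ->
  forall x y z t : G, edge x y -> edge z t ->
  [|| edge x z, edge x t, edge y z | edge y t].
Proof.
move=> G_free x y z t xy zt; apply/negPn/negP.
rewrite !negb_or => /and4P[xz xt yz yt]; apply: G_free.
have neq (u v w : G) : edge u w -> ~~ edge v w -> u != v.
  by move=> uw; apply: contraNneq => <-.
have yx : edge y x by rewrite edge_sym.
have tz : edge t z by rewrite edge_sym.
have zx : ~~ edge z x by rewrite edge_sym.
have tx : ~~ edge t x by rewrite edge_sym.
have zy : ~~ edge z y by rewrite edge_sym.
have ty : ~~ edge t y by rewrite edge_sym.
have all_uniq : uniq [:: x; y; z; t].
  rewrite /= !inE !negb_or (neq _ _ _ xy zy) (neq _ _ _ xy ty).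
  rewrite (neq _ _ _ yx zx) (neq _ _ _ yx tx) !andbT.
  by rewrite (neq _ _ y xy) ?(neq _ _ t zt) ?edge_irrefl.
exists (fun i : 'I_4 => nth x [:: x; y; z; t] i); split.
  by move=> i j /eqP; rewrite nth_uniq // => /eqP/val_inj.
case=> [[|[|[|[|//]]]] ?] [[|[|[|[|//]]]] ?];
  by first [assumption | exact: edge_irrefl | exact: negbTE].
Qed.

Lemma K4_free_edges (G : sgraph) : free G K4 -> forall x y z t : G,
  ~~ [&& edge x y, edge x z, edge x t, edge y z, edge y t & edge z t].
Proof.
move=> G_free x y z t; apply/negP=> /and5P[xy xz xt yz /andP[yt zt]].
apply: G_free.
have neq (u v : G) : edge u v -> u != v.
  by move=> uv; apply: contraTneq uv => ->; rewrite edge_irrefl.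
have all_uniq : uniq [:: x; y; z; t] by rewrite /= !inE !negb_or !neq.
exists (fun i : 'I_4 => nth x [:: x; y; z; t] i); split.
  by move=> i j /eqP; rewrite nth_uniq // => /eqP/val_inj.
case=> [[|[|[|[|//]]]] ?] [[|[|[|[|//]]]] ?];
  by first [assumption | exact: edge_irrefl | rewrite edge_sym; assumption].
Qed.

Lemma B10_adjE (i j : B10) : edge i j = B10_adj i j.
Proof.
case: i j => [i i_lt] [j j_lt].
do 10![case: i i_lt => [|i] i_lt;
  first by do 10![case: j j_lt => [|j] j_lt; first by []]].
by [].
Qed.

(** Each target was chosen as a normal form with four colours; the vertices are
in the order of the rows, c1 first and the added vertices last. *)
Lemma search_B10 : search 4 (ext_rows [::]) [:: 3; 2; 3; 0; 2; 1; 1; 1; 0; 0].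
Proof. by vm_compute. Qed.

Lemma search_A :
  search 4 (ext_rows [:: typeA]) [:: 3; 2; 0; 1; 0; 3; 2; 2; 1; 1; 0].
Proof. by vm_compute. Qed.

Lemma search_B :
  search 4 (ext_rows [:: typeB]) [:: 3; 2; 3; 1; 2; 0; 2; 0; 1; 1; 0].
Proof. by vm_compute. Qed.

Lemma search_AB :
  search 4 (ext_rows [:: typeA; typeB]) [:: 0; 3; 1; 2; 1; 0; 3; 3; 2; 2; 1; 0].
Proof. by vm_compute. Qed.

Lemma search_C :
  search 4 (ext_rows [:: typeC]) [:: 0; 2; 3; 1; 3; 0; 2; 2; 1; 1; 0].
Proof. by vm_compute. Qed.

Theorem mainTheorem3 (G : sgraph) :
  reduced G -> free G twoK2 -> free G K4 -> contains_induced G B10 ->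
  connected (reconf_graph 5 G).
Proof.
move=> G_reduced /twoK2_free_edges G_2K2 /K4_free_edges G_K4 [f [f_inj f_edge]].
pose b i := f (inord i).
have b_edge i j : i < 10 -> j < 10 -> edge (b i) (b j) = B10_adj i j.
  by move=> i_lt j_lt; rewrite f_edge B10_adjE !inordK.
have b_inj : {in gtn 10 &, injective b}.
  by move=> i j i_lt j_lt /f_inj/(congr1 val) /=; rewrite !inordK.
have types := attached_types G_reduced G_2K2 G_K4 b_edge.
have connected_G := connected_ext G_reduced G_2K2 G_K4 b_edge b_inj.
have adj := compatible_edge G_2K2 G_K4 b_edge.
have twin u v T : profile b u = T -> profile b v = T -> T != typeD -> u = v.
  move=> <- vT; exact: (twin_eq G_reduced G_2K2 G_K4 b_edge (esym vT)).
(* The case of exactly one vertex outside the copy. *)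
have vs_single S target : S \in [:: typeC; typeB; typeA] ->
    search 4 (ext_rows [:: S]) target ->
    forall v, profile b v = S ->
    (forall u, profile b u \in [:: typeC; typeB; typeA] -> profile b u = S) ->
    connected (reconf_graph 5 G).
  move=> S_type S_search v vS only_S.
  have vsE : [seq profile b u | u <- [:: v]] = [:: S] by rewrite -vS.
  refine (connected_G [:: v] target _ _ _ _ _); last by rewrite vsE.
  - by [].
  - by move=> u w; rewrite !inE => /eqP-> /eqP->; rewrite eqxx.
  - move=> u /types /only_S uS; rewrite inE; apply/eqP/(twin _ _ _ uS vS).
    by move: S_type; rewrite !inE => /or3P[] /eqP->.
  - by move=> u; rewrite inE => /eqP->; rewrite vS types_attached.
have incompatible u v S T : profile b u = S -> profile b v = T ->
    ~~ compatible true S T -> ~~ compatible false S T -> False.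
  move=> <- <- /negbTE /adj uv /negbTE /adj; by rewrite uv.
have [/existsP[v /eqP vC]|noC] := boolP [exists v, profile b v == typeC].
  apply: (vs_single _ _ _ search_C v vC) => // u.
  rewrite !inE => /or3P[] /eqP uE //.
    by case: (incompatible _ _ _ _ uE vC).
  by case: (incompatible _ _ _ _ uE vC).
have {noC} noC u : profile b u != typeC.
  by apply: contra noC => uC; apply/existsP; exists u.
have [/existsP[v /eqP vA]|noA] := boolP [exists v, profile b v == typeA];
  have [/existsP[w /eqP wB]|noB] := boolP [exists w, profile b w == typeB].
- have vw : edge v w by rewrite (adj v w false) // vA wB.
  have vwE : [seq profile b u | u <- [:: v; w]] = [:: typeA; typeB].
    by rewrite -vA -wB.
  have search_vw := search_AB; rewrite -vwE in search_vw.
  refine (connected_G [:: v; w] _ _ _ _ _ search_vw).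
  + by rewrite /= inE andbT; apply: contraTneq vw => ->; rewrite edge_irrefl.
  + move=> x y; rewrite !inE => /orP[] /eqP-> /orP[] /eqP->; rewrite ?eqxx //.
    by rewrite edge_sym.
  + move=> u /types; rewrite !inE (negbTE (noC u)) => /or3P[] // /eqP uE.
      by rewrite (twin _ _ _ uE wB) // eqxx orbT.
    by rewrite (twin _ _ _ uE vA) // eqxx.
  + by apply/allP/and3P; rewrite vA wB !types_attached.
- apply: (vs_single _ _ _ search_A v vA) => // u.
  rewrite !inE (negbTE (noC u)) => /or3P[] // /eqP uE //.
  by case/existsP: noB; exists u; apply/eqP.
- apply: (vs_single _ _ _ search_B w wB) => // u.
  rewrite !inE (negbTE (noC u)) => /or3P[//|/eqP //|uA].
  by case/existsP: noA; exists u.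
refine (connected_G [::] _ _ _ _ _ search_B10) => // u /types.
rewrite !inE (negbTE (noC u)) => /or3P[//|uB|uA].
  by case/existsP: noB; exists u.
by case/existsP: noA; exists u.
Qed.
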